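(* The graph $\mathcal{A}_2$ is not $(1,1,2,4)$-packing colorable.
   Context: All graphs are finite and simple. For a non-decreasing sequence $S=(a_1,\ldots,a_r)$ of positive integers, an $S$-packing coloring of a graph $G$ is a partition of $V(G)$ into (possibly empty) sets $A_1,\ldots,A_r$ such that, for every $i$, any two distinct vertices in $A_i$ are at distance greater than $a_i$ in $G$; $G$ is $S$-packing colorable if such a coloring exists. The graph $\mathcal{A}_2$ has vertex set $\{1,\ldots,12\}$ and edges $\{1,2\},\{2,3\},\{1,3\},\{2,4\},\{3,5\},\{4,5\},\{4,6\},\{5,6\},\{1,7\},\{7,8\},\{7,9\},\{8,9\},\{8,10\},\{9,11\},\{10,11\},\{10,12\},\{11,12\},\{6,12\}$. *)

(* Defs.v *)
From mathcomp Require Import all_boot.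
Set Implicit Arguments.
Unset Strict Implicit.
Unset Printing Implicit Defensive.

Record sgraph := SGraph {
  vertex :> finType;
  adj : rel vertex;
  adj_sym : symmetric adj;
  adj_irrefl : irreflexive adj }.

Section Distance.
Variable G : sgraph.
Implicit Types (x y : G) (k a : nat).

Definition walk k x y : bool :=
  [exists p : k.-tuple G, path (@adj G) x p && (last x p == y)].

Lemma connect_walk x y : connect (@adj G) x y -> exists k, walk k x y.
Proof.
case/connectP=> p xp ->; exists (size p).
by apply/existsP; exists (in_tuple p); rewrite xp eqxx.
Qed.

(* [None] is the infinite distance between vertices in distinct components. *)
Definition dist x y : option nat :=
  if @idP (connect (@adj G) x y) is ReflectT xy
  then Some (ex_minn (connect_walk xy)) else None.

Definition dist_gt a x y : bool :=
  if dist x y is Some k then a < k else true.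

Lemma dist_gtP a x y :
  reflect (forall p, path (@adj G) x p -> last x p = y -> a < size p)
          (dist_gt a x y).
Proof.
rewrite /dist_gt /dist; case: {-}_ / idP => [xy | nxy]; last first.
  by apply: ReflectT => p xp lp; case: nxy; apply/connectP; exists p.
case: ex_minnP => k kw kmin.
apply: (iffP idP) => [ak p xp lp | far]; last first.
  by have /existsP[q /andP[xq /eqP lq]] := kw; have:= far q xq lq; rewrite size_tuple.
apply: leq_trans ak (kmin _ _).
by apply/existsP; exists (in_tuple p); rewrite xp lp eqxx.
Qed.

End Distance.

(* Total in [S]: meant for non-decreasing sequences of positive integers.
   The classes [A i] may be empty, hence no use of [finset.partition]. *)
Definition packing_colorable (G : sgraph) (S : seq nat) : Prop :=
  exists A : 'I_(size S) -> {set G},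
    [/\ forall x : G, exists i, x \in A i,
        forall i j, i != j -> [disjoint A i & A j]
      & forall i (x y : G), x \in A i -> y \in A i -> x != y ->
          dist_gt (nth 0 S i) x y].

Definition A2_edges : seq (nat * nat) :=
  [:: (1, 2); (2, 3); (1, 3); (2, 4); (3, 5); (4, 5);
      (4, 6); (5, 6); (1, 7); (7, 8); (7, 9); (8, 9);
      (8, 10); (9, 11); (10, 11); (10, 12); (11, 12); (6, 12)].

(* The ordinal [i : 'I_12] stands for the vertex labelled [i.+1]. *)
Definition A2_adj : rel 'I_12 := fun x y =>
  ((x.+1, y.+1) \in A2_edges) || ((y.+1, x.+1) \in A2_edges).

Lemma A2_adj_sym : symmetric A2_adj.
Proof. by move=> x y; rewrite /A2_adj orbC. Qed.

Lemma A2_adj_irrefl : irreflexive A2_adj.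
Proof. by case; do 12?[case=> //]. Qed.

Definition A2 : sgraph := SGraph A2_adj_sym A2_adj_irrefl.

(* Main.v *)
Require Import Defs.
From mathcomp Require Import all_boot.

Set Implicit Arguments.
Unset Strict Implicit.
Unset Printing Implicit Defensive.

(** The vertices of A2 split into four triangles: 123, 456, 789 and 10 11 12.
    A class with packing distance 1 is an independent set, so the two such
    classes cannot cover a triangle; every triangle therefore contains a
    vertex of class 2 (packing distance 2) or of class 3 (packing distance 4).
    Any two vertices of A2 are within distance 4, so class 3 meets at most one
    triangle, and class 2 meets three of them.  That is impossible: among three
    of the triangles two come from the same half {1..6} or {7..12}, where
    the only vertices of different triangles at distance more than 2 are the
    two ends of the half (1 and 6, or 7 and 12); and each triangle of the other
    half lies within distance 2 of one of these ends.

    The two distance facts are checked by evaluating [near], a computable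
    criterion for being at bounded distance; [triangle_escapes] is the
    covering argument for triangles, and [no_A2_transversal] combines the
    distance facts for one chosen vertex in each triangle. *)

Section Near.
Variables (G : sgraph) (vs : seq G).

(** [walk] quantifies over a finite type of tuples and does not evaluate.
    Here intermediate vertices come from an explicit list, and the conditional
    stops evaluation at non-neighbours. *)
Fixpoint near (k : nat) (x y : G) : bool :=
  (x == y) ||
  if k is k'.+1 then
    has (fun z => if adj x z then near k' z y else false) vs
  else false.

Lemma near_path k x y : near k x y ->
  exists2 p, path (@adj G) x p & last x p = y /\ size p <= k.
Proof.
elim: k x => [|k IHk] x /=; first by rewrite orbF => /eqP ->; exists [::].
case/orP=> [/eqP -> | /hasP[z _]]; first by exists [::].
case: ifP => // xz /IHk[p zp [lp sp]].
by exists (z :: p); rewrite //= xz.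
Qed.

Lemma near_dist_gt k x y : near k x y -> ~~ dist_gt k x y.
Proof.
case/near_path=> p xp [lp sp]; apply/negP => /dist_gtP/(_ p xp lp).
by rewrite ltnNge sp.
Qed.

End Near.

Lemma adj_dist_gt1 (G : sgraph) (x y : G) : adj x y -> ~~ dist_gt 1 x y.
Proof.
move=> xy; apply/negP => /dist_gtP/(_ [:: y]).
by rewrite /= xy => /(_ isT erefl).
Qed.

(** Pigeonhole: two of the three vertices would lie in the same independent
    set. *)
Lemma triangle_escapes (G : sgraph) (P Q : {set G}) (x y z : G) :
    {in P &, forall u v, ~~ adj u v} -> {in Q &, forall u v, ~~ adj u v} ->
    adj x y -> adj x z -> adj y z ->
  exists2 u, u \in [:: x; y; z] & u \notin P :|: Q.
Proof.
move=> indP indQ xy xz yz; apply/hasP; apply: contraT; rewrite -all_predC.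
have notboth (R : {set G}) : {in R &, forall u v, ~~ adj u v} ->
    forall u v : G, adj u v -> ~~ ((u \in R) && (v \in R)).
  by move=> indR u v; apply: contraL => /andP[]; apply: indR.
move: (notboth P indP _ _ xy) (notboth P indP _ _ xz) (notboth P indP _ _ yz).
move: (notboth Q indQ _ _ xy) (notboth Q indQ _ _ xz) (notboth Q indQ _ _ yz).
rewrite /= !inE.
by case: (x \in P); case: (y \in P); case: (z \in P);
   case: (x \in Q); case: (y \in Q); case: (z \in Q).
Qed.

(** Unlike [inord], this form evaluates: the remainder modulo 12 makes the
    bound hold for every [n], and leaves the vertices 1..12 unchanged. *)
Definition label (n : nat) : A2 := Ordinal (ltn_pmod n.-1 (isT : 0 < 12)).

Definition A2_near := @near A2 (map label (iota 1 12)).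

Definition A2_triangle (t : nat) : seq A2 :=
  map label (iota (3 * t).+1 3).

(** The inequality is part of the conclusion because a packing class only
    constrains pairs of distinct vertices. *)
Lemma A2_triangles_close : forall s t, s < t < 4 ->
  {in A2_triangle s & A2_triangle t, forall x y, (x != y) && A2_near 4 x y}.
Proof.
move=> s t st x y xs yt.
have /allP/(_ t): all (fun t => all (fun s => all (fun x => all (fun y =>
   (x != y) && A2_near 4 x y) (A2_triangle t)) (A2_triangle s)) (iota 0 t))
   (iota 0 4) by vm_compute.
case/andP: st => lt_st lt_t4; rewrite mem_iota => /(_ lt_t4).
by move/allP/(_ s); rewrite mem_iota => /(_ lt_st)/allP/(_ x xs)/allP/(_ y yt).
Qed.

(** Two of the triangles share a half.  If their chosen vertices are at
    distance more than 2, they are the two ends of that half, and the third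
    triangle lies within distance 2 of one of them. *)
Lemma A2_three_triangles r s t : r < s < t -> t < 4 ->
  forall x y z, x \in A2_triangle r -> y \in A2_triangle s ->
    z \in A2_triangle t -> [|| A2_near 2 x y, A2_near 2 x z | A2_near 2 y z].
Proof.
case/andP=> lt_rs lt_st lt_t4 x y z xr ys zt.
have /allP/(_ t): all (fun t => all (fun s => all (fun r =>
   all (fun x => all (fun y => all (fun z =>
     [|| A2_near 2 x y, A2_near 2 x z | A2_near 2 y z])
   (A2_triangle t)) (A2_triangle s)) (A2_triangle r))
   (iota 0 s)) (iota 0 t)) (iota 0 4) by vm_compute.
rewrite mem_iota => /(_ lt_t4)/allP/(_ s); rewrite mem_iota => /(_ lt_st).
move/allP/(_ r); rewrite mem_iota => /(_ lt_rs).
by move/allP/(_ x xr)/allP/(_ y ys)/allP/(_ z zt).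
Qed.

(** At most one [f t] lies in [C], so at least three lie in [B]; both
    packing conditions apply because the triangles are disjoint. *)
Lemma no_A2_transversal (B C : {set A2}) (f : nat -> A2) :
    {in B &, forall x y, x != y -> dist_gt 2 x y} ->
    {in C &, forall x y, x != y -> dist_gt 4 x y} ->
    (forall t, t < 4 -> f t \in A2_triangle t) ->
  ~ (forall t, t < 4 -> (f t \in B) || (f t \in C)).
Proof.
move=> packB packC fT fBC.
have oneC s t : s < t < 4 -> f s \in C -> f t \in C -> False.
  move=> st Cs Ct; have /andP[lt_st t4] := st.
  have /andP[ne nr] := A2_triangles_close st (fT s (ltn_trans lt_st t4)) (fT t t4).
  by have:= near_dist_gt nr; rewrite packC.
have notnear s t : s < t < 4 -> f s \in B -> f t \in B -> ~~ A2_near 2 (f s) (f t).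
  move=> st Bs Bt; have /andP[lt_st t4] := st.
  have /andP[ne _] := A2_triangles_close st (fT s (ltn_trans lt_st t4)) (fT t t4).
  by apply/negP => /near_dist_gt; rewrite packB.
have threeB r s t : r < s < t -> t < 4 ->
    f r \in B -> f s \in B -> f t \in B -> False.
  move=> rst t4 Br Bs Bt; have /andP[rs st] := rst.
  have s4 := ltn_trans st t4.
  have:= A2_three_triangles rst t4 (fT r (ltn_trans rs s4)) (fT s s4) (fT t t4).
  by rewrite !(negPf (notnear _ _ _ _ _)) ?rs ?st ?(ltn_trans rs st).
case/orP: (fBC 0 isT) => h0; case/orP: (fBC 1 isT) => h1;
case/orP: (fBC 2 isT) => h2; case/orP: (fBC 3 isT) => h3;
by [ apply: (threeB 0 1 2) | apply: (threeB 0 1 3) | apply: (threeB 0 2 3)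
   | apply: (threeB 1 2 3) | apply: (oneC 0 1) | apply: (oneC 0 2)
   | apply: (oneC 0 3) | apply: (oneC 1 2) | apply: (oneC 1 3)
   | apply: (oneC 2 3) ].
Qed.

Theorem proposition3 : ~ packing_colorable A2 [:: 1; 1; 2; 4].
Proof.
case=> A [coverA _ packA].
pose c i (lti : i < 4) := A (Ordinal lti).
pose P := c 0 isT; pose Q := c 1 isT; pose B := c 2 isT; pose C := c 3 isT.
have indep (i : 'I_4) : nth 0 [:: 1; 1; 2; 4] i = 1 ->
    {in A i &, forall u v, ~~ adj u v}.
  move=> ai u v Au Av; apply/negP => uv; have:= adj_dist_gt1 uv.
  rewrite -ai packA //; apply: contraTneq uv => ->; by rewrite adj_irrefl.
have hit t : t < 4 ->
    exists u, (u \in A2_triangle t) && ((u \in B) || (u \in C)).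
  move=> t4.
  have [u ut uPQ] : exists2 u, u \in A2_triangle t & u \notin P :|: Q.
    by move: t t4; do 4?[case=> [_|]] => //;
      apply: triangle_escapes => //; apply: indep.
  exists u; rewrite ut /=; have [[i i4] ui] := coverA u.
  move: uPQ; rewrite in_setU negb_or => /andP[uP uQ].
  have ui_c lti : u \in c i lti by rewrite /c (bool_irrelevance lti i4).
  case: i i4 ui ui_c => [|[|[|[|//]]]] i4 ui ui_c.
  - by rewrite ui_c in uP.
  - by rewrite ui_c in uQ.
  - by rewrite ui_c.
  - by rewrite ui_c orbT.
pose f t := odflt (label 1)
  [pick u | (u \in A2_triangle t) && ((u \in B) || (u \in C))].
have fP t : t < 4 -> (f t \in A2_triangle t) && ((f t \in B) || (f t \in C)).
  move=> /hit[u uP]; rewrite /f; case: pickP => //= none.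
  by rewrite none in uP.
apply: (@no_A2_transversal B C f).
- by move=> x y Bx By; apply: (packA _ _ _ Bx By).
- by move=> x y Cx Cy; apply: (packA _ _ _ Cx Cy).
- by move=> t /fP/andP[].
- by move=> t /fP/andP[].
Qed.
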